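(* Let $k$ be an $F$-finite field of characteristic $p>0$, let $R$ be a commutative $k$-algebra of finite type, and let $\mathcal{C}$ be an $R$-Cartier algebra. Then every object $M$ of the category of coherent $F$-pure $\mathcal{C}$-modules has finite length in that category, i.e. all chains of $F$-pure $\mathcal{C}$-submodules of $M$ are finite.
   Context: A field $k$ of characteristic $p$ is $F$-finite if $[k:k^p]<\infty$. $R$-Cartier algebra: an $\mathbb{N}$-graded (generally non-commutative) ring $\mathcal{C}=\bigoplus_{e\ge 0}\mathcal{C}_e$ with a ring homomorphism $R\to\mathcal{C}$ whose image is $\mathcal{C}_0$, such that $r\cdot\phi=\phi\cdot r^{p^e}$ for all $r\in R$, $\phi\in\mathcal{C}_e$. Every left $\mathcal{C}$-module $M$ is an $R$-module via $R\to\mathcal{C}_0$; it is coherent if it is finitely generated as an $R$-module. Put $\mathcal{C}_+=\bigoplus_{e\ge1}\mathcal{C}_e$, and let $\mathcal{C}_+M$ be the $\mathcal{C}$-submodule of $M$ generated by all $\phi m$ with $\phi\in\mathcal{C}_+$, $m\in M$. $M$ is $F$-pure if $\mathcal{C}_+M=M$. *)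

(* Defs.v *)
(* Rings are [pzRingType]s throughout, so that the zero ring is allowed. *)
From HB Require Import structures.
From mathcomp Require Import all_boot all_order all_algebra.
From mathcomp Require Import boolp classical_sets cardinality.
Set Implicit Arguments.
Unset Strict Implicit.
Unset Printing Implicit Defensive.
Import GRing.Theory.
Local Open Scope classical_set_scope.
Local Open Scope ring_scope.

(* [k : k^p] < oo: finitely many elements of k span k over the subfield k^p of
   p-th powers; c i ^+ p is an arbitrary scalar of k^p. *)
Definition Ffinite (p : nat) (k : fieldType) : Prop :=
  exists (n : nat) (b : 'I_n -> k), forall x : k,
    exists c : 'I_n -> k, x = \sum_(i < n) (c i ^+ p) * b i.

(* The k-algebra structure of R is given by its structure morphism a. *)
Definition finite_type (k : fieldType) (R : comPzRingType)
    (a : {rmorphism k -> R}) : Prop :=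
  exists s : seq R,
    smallest (fun A : set R => GRing.subring_closed [in A])
             (range a `|` [set` s]) = [set: R].

Record is_graded (C : pzRingType) (gr : nat -> set C) : Prop := {
  graded_zmod : forall e, GRing.zmod_closed [in gr e];
  graded1 : gr 0%N 1;
  gradedM : forall d e x y, gr d x -> gr e y -> gr (d + e)%N (x * y);
  graded_sum : forall x : C, exists (n : nat) (f : nat -> C),
    (forall e, gr e (f e)) /\ x = \sum_(e < n) f e;
  graded_direct : forall (n : nat) (f : nat -> C),
    (forall e, gr e (f e)) -> \sum_(e < n) f e = 0 ->
    forall e, (e < n)%N -> f e = 0 }.

Record is_cartier_algebra (p : nat) (R : comPzRingType) (C : pzRingType)
    (iota : {rmorphism R -> C}) (gr : nat -> set C) : Prop := {
  cartier_graded : is_graded gr;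
  cartier_degree0 : range iota = gr 0%N;
  cartier_commute : forall (e : nat) (r : R) (phi : C), gr e phi ->
    iota r * phi = phi * iota (r ^+ (p ^ e)) }.

Definition coherent (R : comPzRingType) (C : pzRingType)
    (iota : {rmorphism R -> C}) (M : lmodType C) : Prop :=
  exists (n : nat) (g : 'I_n -> M), forall m : M,
    exists r : 'I_n -> R, m = \sum_(i < n) iota (r i) *: g i.

Definition Cplus (C : pzRingType) (gr : nat -> set C) : set C :=
  [set phi | exists (n : nat) (f : nat -> C),
    (forall e, gr e (f e)) /\ phi = \sum_(1 <= e < n) f e].

Definition is_submodule (C : pzRingType) (M : lmodType C) (N : set M) : Prop :=
  GRing.submod_closed [in N].

Definition Cplus_mul (C : pzRingType) (gr : nat -> set C) (M : lmodType C)
    (N : set M) : set M :=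
  smallest (@is_submodule C M) [set phi *: m | phi in Cplus gr & m in N].

(* F-purity of a submodule N of M, as a C-module in its own right: the
   C-submodule of N generated by C_+ N does not depend on the ambient M.
   F-purity of M itself is the case N = [set: M]. *)
Definition Fpure (C : pzRingType) (gr : nat -> set C) (M : lmodType C)
    (N : set M) : Prop :=
  Cplus_mul gr N = N.

(* All chains of F-pure C-submodules of M are finite.  Over a Noetherian R
   every C-submodule of a coherent M is coherent, so these are exactly the
   submodules of M that lie in the category of coherent F-pure C-modules. *)
Definition finite_Fpure_length (C : pzRingType) (gr : nat -> set C)
    (M : lmodType C) : Prop :=
  forall T : set (set M),
    (forall N, T N -> is_submodule N /\ Fpure gr N) ->
    total_on T subset -> finite_set T.

(* Main.v *)
From HB Require Import structures.
Require Import Defs.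
From mathcomp Require Import all_boot all_order all_algebra.
From mathcomp Require Import boolp classical_sets cardinality.
From mathcomp Require Import zify.
Import GRing.Theory.
Local Open Scope classical_set_scope.
Local Open Scope ring_scope.

(** R is noetherian, so only descending chains J_0, J_1, ... of F-pure
    submodules matter; let J be their intersection and (J : J_i) the conductor,
    an ideal that increases with i, hence may be assumed constant, equal to I.
    Suppose 1 is not in I.  Purity makes I radical; choose a colon ideal
    P = (I : x) that is maximal, hence prime.  At P the J_i/J form a chain of
    vector spaces over a field, so from some index i1 on there are scalars c_i
    outside P with c_i J_i1 in J_i.  To make them uniform in i, replace C by
    the maps of gauge growth at most K: for K large they still satisfy
    F(J_i1) = J_i1, where F(N) is the sum of the images of N.  Then
    c_i J_i1 lies in F^n(J_i) for all n, whereas for n large F^n(J_i) is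
    generated by its elements of degree at most 2K + 2, because a
    p^(-e)-linear map divides degrees by p^e up to a constant.  These elements
    form a descending chain in a finite dimensional k-vector space (k being
    F-finite), so they stabilize, and some c_i outside P maps J_i1 into J.
    Thus c_i lies in (J : J_i1) but not in I, a contradiction. *)

Set Implicit Arguments.
Unset Strict Implicit.

(** If every element of [S] had an [r]-successor in [S], dependent choice would build an infinite
    chain. *)
Lemma exists_extremal (X : Type) (r : X -> X -> Prop) (S : set X) :
  (forall f : nat -> X, (forall n, S (f n)) -> ~ forall n, r (f n) (f n.+1)) ->
  S !=set0 -> exists2 x, S x & forall y, S y -> ~ r x y.
Proof.
move=> nochain [x0 Sx0]; apply: contrapT => noext.
have step (x : {x | S x}) : {y : {x | S x} | r (sval x) (sval y)}.
  case: x => x Sx; apply: cid; apply: contrapT => H; apply: noext.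
  by exists x => // y Sy rxy; apply: H; exists (exist _ y Sy).
have [f [_ rf]] := dependent_choice step (exist _ x0 Sx0).
by apply: (nochain (fun n => sval (f n))) => // n; apply: (svalP (f n)).
Qed.

(** * Submodules over a set of scalars, and chain conditions *)

Section Submodules.
Context {R : comPzRingType} {V : lmodType R}.
Implicit Types (A Q : set R) (U N : set V) (J : nat -> set V) (s : seq V).

(** The scalars [A] are any set, so that [k]-subspaces, [R]-submodules and subspaces stable under
    some generators of [R] are all instances. *)
Record submod A N : Prop := Submod {
  submod0 : N 0;
  submodB : forall u v, N u -> N v -> N (u - v);
  submodZ : forall r u, A r -> N u -> N (r *: u) }.

Lemma submodD A N u v : submod A N -> N u -> N v -> N (u + v).
Proof.
move=> sN Nu Nv; rewrite -[v]opprK; apply: (submodB sN) => //.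
by rewrite -sub0r; apply: (submodB sN) => //; apply: submod0 sN.
Qed.

Lemma submodS A B N : A `<=` B -> submod B N -> submod A N.
Proof.
move=> AB sN; split; [exact: (submod0 sN)| exact: (submodB sN)|].
by move=> r u /AB; apply: submodZ.
Qed.

Lemma submodI A N N' : submod A N -> submod A N' -> submod A (N `&` N').
Proof.
move=> sN sN'; split=> [|u v [Nu N'u] [Nv N'v]|r u Ar [Nu N'u]].
- by split; [apply: submod0 sN | apply: submod0 sN'].
- by split; [apply: (submodB sN) | apply: (submodB sN')].
- by split; [apply: (submodZ sN) | apply: (submodZ sN')].
Qed.

Lemma descending_le J i j :
  (forall i, J i.+1 `<=` J i) -> (i <= j)%N -> J j `<=` J i.
Proof.
by move=> dJ /subnK <-; elim: (j - i)%N => [//|n IH] v /dJ; apply: IH.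
Qed.

Lemma ascending_le J i j :
  (forall i, J i `<=` J i.+1) -> (i <= j)%N -> J i `<=` J j.
Proof.
by move=> dJ /subnK <-; elim: (j - i)%N => [//|n IH] v /IH; apply: dJ.
Qed.

Fixpoint lspan A s : set V :=
  if s is g :: s' then
    [set v | exists r u, [/\ A r, lspan A s' u & v = r *: g + u]]
  else [set 0].

Record subring A : Prop := Subring {
  subring1 : A 1;
  subringB : forall x y, A x -> A y -> A (x - y);
  subringM : forall x y, A x -> A y -> A (x * y) }.

Lemma subring0 A : subring A -> A 0.
Proof. by move=> rA; rewrite -(subrr 1); apply: subringB => //; apply: subring1. Qed.

Lemma submod_lspan A s : subring A -> submod A (lspan A s).
Proof.
move=> rA; elim: s => [|g s IH] /=.
  split=> [//|u v -> ->|r u _ ->]; first by rewrite subr0.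
  by rewrite scaler0.
split.
- exists 0, 0; split; [exact: subring0|exact: (submod0 IH)|by rewrite scale0r addr0].
- move=> _ _ [r [u [Ar su ->]]] [r' [u' [Ar' su' ->]]].
  exists (r - r'), (u - u'); split; [exact: subringB|exact: (submodB IH su su')|].
  by rewrite scalerBl addrACA opprD.
- move=> c _ Ac [r [u [Ar su ->]]].
  exists (c * r), (c *: u); split; [exact: subringM|exact: (submodZ IH Ac su)|].
  by rewrite scalerDr scalerA.
Qed.

Lemma lspan_mem A s v : subring A -> v \in s -> lspan A s v.
Proof.
move=> rA; elim: s => [//|g s IH]; rewrite inE => /orP[/eqP ->|/IH sv] /=.
  exists 1, 0; split; [exact: subring1|exact: (submod0 (submod_lspan s rA))|].
  by rewrite scale1r addr0.
by exists 0, v; split=> //; [exact: subring0|rewrite scale0r add0r].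
Qed.

Lemma lspan_min A s N :
  submod A N -> (forall v, v \in s -> N v) -> lspan A s `<=` N.
Proof.
move=> sN; elim: s => [|g s IH] sub v /=; first by move=> ->; apply: submod0 sN.
move=> [r [u [Ar su ->]]]; apply: (submodD sN).
  by apply: (submodZ sN) => //; apply: sub; rewrite mem_head.
by apply: IH su => w sw; apply: sub; rewrite inE sw orbT.
Qed.

Lemma subringT : subring [set: R]. Proof. by split=> *; exact: I. Qed.

Definition acc A U : Prop := forall J,
  (forall i, submod A (J i)) -> (forall i, J i `<=` U) ->
  (forall i, J i `<=` J i.+1) -> exists n, forall i, (n <= i)%N -> J i `<=` J n.

Lemma acc_fg U N : acc setT U -> submod setT N -> N `<=` U ->
  exists s, N = lspan setT s.
Proof.
move=> accU sN NU.
pose S : set (seq V) := [set s | forall v, v \in s -> N v].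
pose lt s s' := lspan setT s `<=` lspan setT s' /\
  ~ lspan setT s' `<=` lspan setT s.
have [||s Ss smax] := @exists_extremal _ lt S.
- move=> f Sf ltf; have [| | |n] := accU (fun n => lspan setT (f n)).
  + by move=> i; apply: submod_lspan subringT.
  + by move=> i v /(lspan_min sN (Sf i)); apply: NU.
  + by move=> i; case: (ltf i).
  + by move/(_ n.+1 (leqnSn n)); case: (ltf n).
- by exists [::].
exists s; apply/seteqP; split; last exact: lspan_min.
move=> v Nv; apply: contrapT => nv; apply: (smax (v :: s)).
  by move=> w; rewrite inE => /orP[/eqP ->|/Ss].
split=> [u su|sub]; last by apply/nv/sub/lspan_mem; rewrite ?mem_head.
by exists 0, u; split; rewrite // scale0r add0r.
Qed.

(* Modulo torsion with respect to the multiplicative set [Q], each generator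
   contributes rank at most one; [x] kills the scalars outside [Q]. *)
Lemma generic_dcc A Q s x J :
  subring A -> Q `<=` A -> (forall r r', Q r -> Q r' -> Q (r * r')) -> Q x ->
  (forall i, submod A (J i)) -> (forall i, J i.+1 `<=` J i) ->
  (forall i, J i `<=` lspan A s) ->
  (forall i r g, A r -> ~ Q r -> g \in s -> J i (x *: (r *: g))) ->
  exists n, forall i, (n <= i)%N ->
    exists2 c, Q c & forall v, J n v -> J i (c *: v).
Proof.
move=> rA QA QM Qx; elim: s J => [|g s IH] J sJ dJ Js tors.
  exists 0%N => i _; exists x => // v /Js /= ->.
  by rewrite scaler0; apply: submod0 (sJ i).
have sS := submod_lspan s rA.
have [|||i r h Ar nQr sh|n0 Hn0] := IH (fun i => J i `&` lspan A s).
- by move=> i; apply: submodI.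
- by move=> i v [Jv sv]; split=> //; apply: dJ.
- by move=> i v [].
- split; first by apply: tors => //; rewrite inE sh orbT.
  by apply: (submodZ sS); [apply: QA|apply: (submodZ sS) => //; apply: lspan_mem].
(* If every [J i] has an element whose coefficient [t] at [g] is in [Q], cross-multiplication moves
   [t *: v] into the span of [s], where the induction hypothesis applies. *)
have [big|] := pselect (forall i, exists2 t, Q t &
    exists2 w, lspan A s w & J i (t *: g + w)).
  exists n0 => i n0i; have [t Qt [w sw Jtw]] := big i.
  have [c Qc Hc] := Hn0 i n0i.
  exists (c * t) => [|v Jv]; first exact: QM.
  have [r [u [Ar su vE]]] := Js _ _ Jv.
  have eq1 : t *: v - r *: (t *: g + w) = t *: u - r *: w.
    by rewrite vE !scalerDr !scalerA (mulrC r) opprD addrACA subrr add0r.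
  have [|Jc _] := Hc (t *: v - r *: (t *: g + w)).
    split; last first.
      by rewrite eq1; apply: (submodB sS); apply: (submodZ sS) => //; apply: QA.
    apply: (submodB (sJ _)); first by apply: (submodZ (sJ _)) => //; apply: QA.
    by apply: (submodZ (sJ _)) => //; apply: (descending_le dJ n0i).
  rewrite -scalerA -[t *: v](subrK (r *: (t *: g + w))) scalerDr.
  apply: (submodD (sJ _)) => //; apply: (submodZ (sJ _)); first exact: QA.
  exact: (submodZ (sJ _)).
(* Otherwise, from [n1] on, all coefficients at [g] are outside [Q], and multiplication by [x] puts
   the [g]-part into every [J j]. *)
move=> /existsNP[n1 small]; exists (maxn n0 n1) => i; rewrite geq_max.
move=> /andP[n0i n1i]; have [c Qc Hc] := Hn0 i n0i.
exists (c * x) => [|v Jv]; first exact: QM.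
have [r [u [Ar su vE]]] := Js _ _ Jv.
have nQr : ~ Q r.
  move=> Qr; apply: small; exists r => //; exists u => //; rewrite -vE.
  exact: (descending_le dJ (leq_maxr n0 n1)).
have xrg j : J j (x *: (r *: g)) by apply: tors => //; rewrite mem_head.
have Jxu : J n0 (x *: u).
  have -> : x *: u = x *: v - x *: (r *: g) by rewrite vE scalerDr addrC addKr.
  apply: (submodB (sJ _)) => //; apply: (submodZ (sJ _)); first exact: QA.
  exact: (descending_le dJ (leq_maxl n0 n1)).
have [|Jcxu _] := Hc (x *: u).
  by split=> //; apply: (submodZ sS) => //; apply: QA.
rewrite vE -scalerA 2!scalerDr; apply: (submodD (sJ _)) => //.
by apply: (submodZ (sJ _)); first exact: QA.
Qed.

(** * Chain conditions for finite dimensional spaces over a field *)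

Section Field.
Context {k : fieldType} (a : {rmorphism k -> R}).

Lemma subring_range : subring (range a).
Proof.
split; first by exists 1 => //; rewrite rmorph1.
  by move=> _ _ [c _ <-] [d _ <-]; exists (c - d); rewrite ?rmorphB.
by move=> _ _ [c _ <-] [d _ <-]; exists (c * d); rewrite ?rmorphM.
Qed.

(** This is [generic_dcc] with the nonzero scalars as [Q] and [x = 1]; the scalar obtained is
    invertible. *)
Lemma field_dcc s J :
  (forall i, submod (range a) (J i)) -> (forall i, J i.+1 `<=` J i) ->
  (forall i, J i `<=` lspan (range a) s) ->
  exists n, forall i, (n <= i)%N -> J n `<=` J i.
Proof.
move=> sJ dJ Js.
have [||||n Hn] := @generic_dcc (range a) (a @` [set c | c != 0]) s 1 J
    subring_range _ _ _ sJ dJ Js.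
- by move=> _ [c _ <-]; exists c.
- move=> _ _ [c c0 <-] [d d0 <-]; exists (c * d); rewrite ?rmorphM //=.
  by rewrite mulf_neq0.
- by exists 1; rewrite ?rmorph1 //= oner_neq0.
- move=> i r g [c _ <-] nQ _; have [-> |c0] := eqVneq c 0.
    by rewrite rmorph0 scale0r scaler0; apply: submod0 (sJ i).
  by case: nQ; exists c.
exists n => i /Hn[_ [c c0 <-] Hc] v /Hc Jv.
have -> : v = a c^-1 *: (a c *: v).
  by rewrite scalerA -rmorphM mulVf // rmorph1 scale1r.
by apply: (submodZ (sJ i)) => //; exists c^-1.
Qed.

(** Once some member contains [w] with nonzero coefficient at [g], subtracting a multiple of [w]
    brings later elements into the span of the other generators. *)
Lemma field_acc s : acc (range a) (lspan (range a) s).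
Proof.
elim: s => [|g s IH] J sJ Js aJ.
  by exists 0%N => i _ v /Js ->; apply: submod0 (sJ _).
have sS := submod_lspan s subring_range.
have [|||n0 Hn0] := IH (fun i => J i `&` lspan (range a) s).
- by move=> i; apply: submodI.
- by move=> i v [].
- by move=> i v [Jv sv]; split=> //; apply: aJ.
have [small|] := pselect (forall i, J i `<=` lspan (range a) s).
  by exists n0 => i n0i v Jv; apply: (Hn0 i n0i v _).1; split=> //; apply: small Jv.
move=> /existsNP[n1 /existsNP[w /not_implyP[Jw sw]]].
have [_ [u [[c _ <-] su wE]]] := Js _ _ Jw.
have c0 : c != 0.
  by apply/eqP => c0; apply: sw; rewrite wE c0 rmorph0 scale0r add0r.
pose n := maxn n0 n1.
have Jnw : J n w := ascending_le aJ (leq_maxr n0 n1) Jw.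
exists n => i ni v Jv; have [_ [u' [[d _ <-] su' vE]]] := Js _ _ Jv.
have n0i : (n0 <= i)%N := leq_trans (leq_maxl _ _) ni.
pose b := a (d / c).
have eq1 : v - b *: w = u' - b *: u.
  rewrite vE wE scalerDr scalerA -rmorphM divfK // opprD addrACA subrr.
  by rewrite add0r.
rewrite -[v](subrK (b *: w)); apply: (submodD (sJ n)); last first.
  by apply: (submodZ (sJ n)) => //; exists (d / c).
apply: (ascending_le aJ (leq_maxl n0 n1)); apply: (Hn0 i n0i _ _).1; split.
  apply: (submodB (sJ i)) => //; apply: (submodZ (sJ i)); first by exists (d / c).
  exact: ascending_le aJ ni _ Jnw.
by rewrite eq1; apply: (submodB sS) => //; apply: (submodZ sS) => //; exists (d / c).
Qed.

End Field.

(** * Hilbert's basis theorem *)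

Section Hilbert.
Variables (A : set R) (t : R) (U : set V).
Hypothesis sU : submod A U.

(** Values at [t] of polynomials of degree below [d] over [U]. As [t] is no indeterminate, such
    expressions need not be unique; [lead] therefore asks for some expression. *)
Fixpoint poly_lt d : set V :=
  if d is d'.+1 then
    [set v | exists u w, [/\ U u, poly_lt d' w & v = t ^+ d' *: u + w]]
  else [set 0].

Definition poly_ext : set V := \bigcup_d poly_lt d.

Lemma submod_poly_lt d : submod A (poly_lt d).
Proof.
elim: d => [|d IH] /=.
  split=> [//|u v -> ->|r u _ ->]; first by rewrite subr0.
  by rewrite scaler0.
split.
- exists 0, 0; split; [exact: (submod0 sU)|exact: (submod0 IH)|].
  by rewrite scaler0 addr0.
- move=> _ _ [u [w [Uu dw ->]]] [u' [w' [Uu' dw' ->]]].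
  exists (u - u'), (w - w').
  split; [exact: (submodB sU Uu Uu')|exact: (submodB IH dw dw')|].
  by rewrite scalerBr addrACA opprD.
- move=> c _ Ac [u [w [Uu dw ->]]].
  exists (c *: u), (c *: w).
  split; [exact: (submodZ sU Ac Uu)|exact: (submodZ IH Ac dw)|].
  by rewrite scalerDr !scalerA mulrC.
Qed.

Lemma poly_lt_mono d e : (d <= e)%N -> poly_lt d `<=` poly_lt e.
Proof.
apply: ascending_le => i v dv /=.
by exists 0, v; split; rewrite ?scaler0 ?add0r //; apply: submod0 sU.
Qed.

Lemma poly_ltX d v : poly_lt d v -> poly_lt d.+1 (t *: v).
Proof.
elim: d v => [v ->|d IH _ [u [w [Uu dw ->]]]].
  by exists 0, 0; split; rewrite ?scaler0 ?addr0 //; apply: submod0 sU.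
exists u, (t *: w); split=> //; first exact: IH.
by rewrite scalerDr scalerA -exprS.
Qed.

Lemma submod_poly_ext : submod (t |` A) poly_ext.
Proof.
split; first by exists 0%N.
  move=> u v [d _ du] [e _ ev]; exists (maxn d e) => //.
  apply: (submodB (submod_poly_lt _)).
    exact: poly_lt_mono (leq_maxl _ _) _ du.
  exact: poly_lt_mono (leq_maxr _ _) _ ev.
move=> r u [->|Ar] [d _ du]; first by exists d.+1 => //; apply: poly_ltX.
by exists d => //; apply: (submodZ (submod_poly_lt _)).
Qed.

Lemma poly_ext_base : U `<=` poly_ext.
Proof.
by move=> u Uu; exists 1%N => //; exists u, 0; rewrite expr0 scale1r addr0.
Qed.

Definition lead N d : set V :=
  [set u | U u /\ exists2 w, poly_lt d w & N (t ^+ d *: u + w)].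

Lemma submod_lead N d : submod A N -> submod A (lead N d).
Proof.
move=> sN; split.
- split; first exact: (submod0 sU).
  exists 0; first exact: (submod0 (submod_poly_lt d)).
  by rewrite scaler0 addr0; apply: submod0 sN.
- move=> u v [Uu [w dw Nw]] [Uv [w' dw' Nw']]; split; first exact: (submodB sU Uu Uv).
  exists (w - w'); first exact: (submodB (submod_poly_lt d) dw dw').
  by rewrite scalerBr addrACA -opprD; apply: (submodB sN).
- move=> r u Ar [Uu [w dw Nw]]; split; first exact: (submodZ sU Ar Uu).
  exists (r *: w); first exact: (submodZ (submod_poly_lt d) Ar dw).
  by rewrite scalerA mulrC -scalerA -scalerDr; apply: (submodZ sN).
Qed.

Lemma lead_step N d : submod (t |` A) N -> lead N d `<=` lead N d.+1.
Proof.
move=> sN u [Uu [w dw Nw]]; split=> //; exists (t *: w); first exact: poly_ltX.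
by rewrite exprS -scalerA -scalerDr; apply: (submodZ sN) => //; left.
Qed.

Lemma leadS N N' d : N `<=` N' -> lead N d `<=` lead N' d.
Proof. by move=> NN' u [Uu [w dw /NN' N'w]]; split=> //; exists w. Qed.

(** Induction on the degree: subtracting an element of [N] with the same leading coefficient lowers
    it. *)
Lemma lead_sub N N' : submod A N -> submod A N' -> N `<=` N' ->
  N' `<=` poly_ext -> (forall d, lead N' d `<=` lead N d) -> N' `<=` N.
Proof.
move=> sN sN' NN' N'ext HN.
suff H d v : N' v -> poly_lt d v -> N v.
  by move=> v N'v; have [d _] := N'ext v N'v; apply: H.
elim: d v => [v N'v ->|d IH v N'v [u [w [Uu dw vE]]]]; first exact: (submod0 sN).
have [|_ [w' dw' Nw']] := HN d u; first by split=> //; exists w; rewrite // -vE.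
rewrite -[v](subrK (t ^+ d *: u + w')); apply: (submodD sN) => //.
apply: IH; first by apply: (submodB sN') => //; apply: NN'.
rewrite vE opprD addrACA subrr add0r.
exact: (submodB (submod_poly_lt d) dw dw').
Qed.

(** The diagonal chain [lead (J i) i] controls all degrees from [n0] on; the finitely many smaller
    ones are treated one by one. *)
Lemma acc_poly_ext : acc A U -> acc (t |` A) poly_ext.
Proof.
move=> accU J sJ Jext aJ.
have sJA i : submod A (J i) by apply: submodS (sJ i) => r; right.
have aL d i j : (i <= j)%N -> lead (J i) d `<=` lead (J j) d.
  by move=> ij; apply/leadS/(ascending_le aJ ij).
have [|||n0 Hn0] := accU (fun i => lead (J i) i).
- by move=> i; apply: submod_lead.
- by move=> i u [].
- by move=> i u /(lead_step (sJ i)); apply: aL.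
have [m Hm] : exists m, forall d i, (d < n0)%N -> (m <= i)%N ->
    lead (J i) d `<=` lead (J m) d.
  elim: n0 {Hn0} => [|n [m Hm]]; first by exists 0%N.
  have [|||l Hl] := accU (fun i => lead (J i) n).
  - by move=> i; apply: submod_lead.
  - by move=> i u [].
  - by move=> i; apply: aL.
  exists (maxn m l) => d i; rewrite ltnS leq_eqVlt geq_max.
  move=> /orP[/eqP ->|dn] /andP[mi li].
    by move=> u /(Hl i li); apply/aL/leq_maxr.
  by move=> u /(Hm d i dn mi); apply/aL/leq_maxl.
exists (maxn n0 m) => i; rewrite geq_max => /andP[n0i mi].
apply: lead_sub => //.
  by apply: ascending_le aJ _; rewrite geq_max n0i.
move=> d; case: (ltnP d n0) => dn0.
  by move=> u /(Hm d i dn0 mi); apply/aL/leq_maxr.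
have aD e f j : (e <= f)%N -> lead (J j) e `<=` lead (J j) f.
  by apply: ascending_le => l; apply: lead_step.
move=> u Lu; have : lead (J n0) n0 u.
  apply: (Hn0 (maxn i d)); first by rewrite leq_max n0i.
  by apply: (aL _ i); rewrite ?leq_maxl //; apply: aD Lu; rewrite leq_maxr.
by move=> /(aD _ _ _ dn0); apply/aL/leq_maxl.
Qed.

End Hilbert.

(** Starting from the span of [s] over the field, the algebra generators of [R] are adjoined one at
    a time by [acc_poly_ext]. *)
Lemma noetherian (k : fieldType) (a : {rmorphism k -> R}) s :
  finite_type a -> acc setT (lspan setT s).
Proof.
move=> [ts Hts].
pose A (l : seq R) := range a `|` [set` l].
have [U [sU accU baseU]] : exists U, [/\ submod (A ts) U, acc (A ts) U &
    lspan (range a) s `<=` U].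
  elim: ts {Hts} => [|t ts [U [sU accU baseU]]].
    exists (lspan (range a) s).
    have -> : A [::] = range a by apply/seteqP; split=> [r []|r] //; left.
    by split=> //; [apply/submod_lspan/subring_range|exact: field_acc].
  have -> : A (t :: ts) = t |` A ts.
    apply/seteqP; split=> r.
      case=> [ar|]; first by right; left.
      by rewrite /= inE => /orP[/eqP ->|tr]; [left|right; right].
    move=> [->|[ar|tr]]; [right|by left|right]; rewrite /= inE ?eqxx //.
    by rewrite [_ \in ts]tr orbT.
  exists (poly_ext t U); split; [exact: submod_poly_ext|exact: acc_poly_ext|].
  by move=> v /baseU; apply: poly_ext_base.
(* The scalars preserving [U] form a subring containing the generators, hence all of [R]. *)
have sUT : submod setT U.
  split; [exact: (submod0 sU)|exact: (submodB sU)|move=> r u _ Uu].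
  have : [set: R] r by [].
  rewrite -Hts => /(_ [set r | forall u, U u -> U (r *: u)]).
  apply=> //; split; last by move=> x Ax v; apply: (submodZ sU).
  split; first by rewrite inE => v; rewrite scale1r.
    move=> x y; rewrite !inE => Hx Hy v Uv; rewrite scalerBl.
    by apply: (submodB sU); [apply: Hx|apply: Hy].
  by move=> x y; rewrite !inE => Hx Hy v /Hy /Hx; rewrite scalerA.
move=> J sJ Js aJ; apply: accU => // i.
  exact: submodS (sJ i).
move=> v /Js; apply: lspan_min => // w sw; apply: baseU.
by apply: lspan_mem => //; apply: subring_range.
Qed.

End Submodules.

(** * Gauges *)

(** Cartier maps respect sums but only twist scalars, so spans are purely additive and scalars are
    built into [X]. *)
Inductive addspan {W : zmodType} (X : set W) : W -> Prop :=
| addspan0 : addspan X 0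
| addspan_cons x y : X x -> addspan X y -> addspan X (x + y).

Section Addspan.
Context {W : zmodType}.
Implicit Types (X P : set W).

Lemma addspan_mem X x : X x -> addspan X x.
Proof. by move=> Xx; rewrite -[x]addr0; apply: addspan_cons => //; apply: addspan0. Qed.

Lemma addspan_min X P : P 0 -> (forall x y, P x -> P y -> P (x + y)) ->
  X `<=` P -> addspan X `<=` P.
Proof. by move=> P0 PD XP x; elim=> // {}x y /XP Px _; apply: PD. Qed.

Lemma addspanD X x y : addspan X x -> addspan X y -> addspan X (x + y).
Proof.
move=> Xx Xy; elim: Xx => [|z t Xz _ IH]; first by rewrite add0r.
by rewrite -addrA; apply: addspan_cons.
Qed.

Lemma addspanS X P : X `<=` addspan P -> addspan X `<=` addspan P.
Proof.
by move=> XP; apply: addspan_min => // [|x y]; [apply: addspan0|apply: addspanD].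
Qed.

Lemma addspan_sum X (I : finType) (F : I -> W) :
  (forall i, addspan X (F i)) -> addspan X (\sum_i F i).
Proof.
by move=> XF; apply: big_ind => // [|x y]; [apply: addspan0|apply: addspanD].
Qed.

End Addspan.

Lemma addspan_map {W W' : zmodType} (X : set W) (Y : set W') (f : W -> W') :
  {morph f : x y / x + y} -> (forall x, X x -> addspan Y (f x)) ->
  forall x, addspan X x -> addspan Y (f x).
Proof.
move=> fD XY x; elim=> [|{}x y Xx _ Yy]; last first.
  by rewrite fD; apply: addspanD => //; apply: XY.
have -> : f 0 = 0 by apply: (addrI (f 0)); rewrite -fD !addr0.
exact: addspan0.
Qed.

Lemma submod_addspan (R : comPzRingType) (V : lmodType R) (A : set R)
    (X : set V) : A (- 1) -> (forall r x, A r -> X x -> X (r *: x)) ->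
  submod A (addspan X).
Proof.
move=> A1 AX.
have XZ r u : A r -> addspan X u -> addspan X (r *: u).
  move=> Ar; apply: addspan_map => [x y|x Xx]; first by rewrite scalerDr.
  by apply: addspan_mem; apply: AX.
split=> //; first exact: addspan0.
by move=> u v Xu Xv; apply: addspanD => //; rewrite -scaleN1r; apply: XZ.
Qed.

(** Each coefficient over the [p]-th powers is expanded again; additivity of Frobenius carries the
    expansion through. *)
Lemma Ffinite_iter (p : nat) (k : fieldType) (e : nat) :
  p \in [pchar k] -> Ffinite p k ->
  exists B : seq k, forall x : k,
    addspan [set y | exists c b, b \in B /\ y = c ^+ (p ^ e) * b] x.
Proof.
move=> hp [n [b Hb]]; elim: e => [|e [B HB]].
  exists [:: 1] => x; apply: addspan_mem; exists x, 1.
  by rewrite mem_head expn0 expr1 mulr1.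
exists [seq y ^+ p * b i | y <- B, i <- enum 'I_n] => x.
have [c ->] := Hb x; apply: addspan_sum => i.
apply: (addspan_map (f := fun y => y ^+ p * b i)) (HB (c i)) => [y z|_ [d [y [By ->]]]].
  by rewrite -!(pFrobenius_autE hp) rmorphD mulrDl.
apply: addspan_mem; exists d, (y ^+ p * b i); split.
  by apply: allpairs_f; rewrite ?mem_enum.
by rewrite exprMn -exprM -expnSr mulrA.
Qed.

Section Gauge.
Context {k : fieldType} {R : comPzRingType} (a : {rmorphism k -> R}).
Variable t : seq R.

Definition mon (al : 'I_(size t) -> nat) : R :=
  \prod_(i < size t) t`_i ^+ al i.

Lemma monD al be : mon (fun i => al i + be i)%N = mon al * mon be.
Proof. by rewrite -big_split; apply: eq_bigr => i _; rewrite exprD. Qed.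

Lemma monX al n : mon (fun i => al i * n)%N = mon al ^+ n.
Proof. by rewrite -prodrXl; apply: eq_bigr => i _; rewrite exprM. Qed.

(** Each exponent is bounded separately, not the total degree, so that dividing exponents by [q]
    divides the bound. *)
Definition deg_le d : set R := addspan [set x |
  exists c al, (forall i, (al i <= d)%N) /\ x = a c * mon al].

Lemma deg_leS d e : (d <= e)%N -> deg_le d `<=` deg_le e.
Proof.
move=> de; apply: addspanS => _ [c [al [Hal ->]]]; apply: addspan_mem.
by exists c, al; split=> // i; apply: leq_trans de.
Qed.

Lemma deg_leM d e x y : deg_le d x -> deg_le e y -> deg_le (d + e) (x * y).
Proof.
move=> dx ey; apply: (addspan_map (f := fun x => x * y)) dx => [u v|].
  exact: mulrDl.
move=> _ [c [al [Hal ->]]]; move: y ey; apply: addspan_map => [u v|].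
  exact: mulrDr.
move=> _ [c' [be [Hbe ->]]]; apply: addspan_mem.
exists (c * c'), (fun i => al i + be i)%N; split=> [i|]; first exact: leq_add.
by rewrite monD rmorphM mulrACA.
Qed.

Lemma deg_le_scalar d c : deg_le d (a c).
Proof.
apply: addspan_mem; exists c, (fun=> 0)%N; split=> //.
by rewrite /mon big1 ?mulr1.
Qed.

Lemma deg_leB d x y : deg_le d x -> deg_le d y -> deg_le d (x - y).
Proof.
move=> dx dy; apply: addspanD => //; move: y dy.
apply: (addspan_map (f := -%R)) => [u v|]; first exact: opprD.
move=> _ [c [al [Hal ->]]]; apply: addspan_mem; exists (- c), al; split=> //.
by rewrite rmorphN mulNr.
Qed.

Lemma deg_le_exhaust :
  smallest (fun A : set R => GRing.subring_closed [in A])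
           (range a `|` [set` t]) = [set: R] ->
  forall x, exists d, deg_le d x.
Proof.
move=> Ht x; have : [set: R] x by [].
rewrite -Ht => /(_ [set x | exists d, deg_le d x]); apply; split.
  split; first by rewrite inE; exists 0%N; rewrite -(rmorph1 a); apply: deg_le_scalar.
    move=> u v; rewrite !inE => -[d du] [e ev]; exists (maxn d e).
    apply: deg_leB; first exact: deg_leS (leq_maxl _ _) _ du.
    exact: deg_leS (leq_maxr _ _) _ ev.
  move=> u v; rewrite !inE => -[d du] [e ev]; exists (d + e)%N.
  exact: deg_leM.
move=> u [[c _ <-]|/= ut]; first by exists 0%N; apply: deg_le_scalar.
exists 1%N; apply: addspan_mem; move: ut => /(nthP 0)[i it <-].
exists 1, (fun j => (j == Ordinal it) : nat); split=> [j|]; first by case: eqP.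
rewrite /mon rmorph1 mul1r (bigD1 (Ordinal it)) //= eqxx expr1 big1 ?mulr1 //.
by move=> j /negbTE ->.
Qed.

(* [R] is finite over its subring of [q]-th powers; dividing the exponents of
   a monomial by [q] divides the degree by [q]. *)
Lemma deg_le_frobenius p e : p \in [pchar k] -> Ffinite p k ->
  exists2 H : seq R, (forall h, h \in H -> deg_le (p ^ e) h) &
    forall d x, deg_le d x -> addspan [set y | exists c h,
      [/\ deg_le (d %/ p ^ e) c, h \in H & y = c ^+ (p ^ e) * h]] x.
Proof.
move=> hp hk; have [B HB] := Ffinite_iter e hp hk.
set q := (p ^ e)%N.
have q0 : (0 < q)%N by rewrite expn_gt0 prime_gt0 ?(pcharf_prime hp).
(* The exponents are remainders modulo [q]; the type ['I_q.+1] has the successor form that [inord]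
   needs. *)
pose H := [seq a b * mon (fun i => f i : nat) | b <- B,
  f : {ffun 'I_(size t) -> 'I_q.+1} <- enum {ffun 'I_(size t) -> 'I_q.+1}].
exists H.
  move=> h /allpairsP[[b f] /= [_ _ ->]]; apply: addspan_mem.
  by exists b, (fun i => f i : nat); split=> // i; rewrite -ltnS.
move=> d; apply: addspanS => _ [c [al [Hal ->]]].
pose f := [ffun i : 'I_(size t) => inord (al i %% q) : 'I_q.+1].
have -> : mon al = mon (fun i => al i %/ q)%N ^+ q * mon (fun i => f i : nat).
  rewrite -monX -monD; apply: eq_bigr => i _; congr (_ ^+ _).
  by rewrite ffunE inordK ?ltnS ?(ltnW (ltn_pmod _ _)) // -divn_eq.
apply: (addspan_map (f := fun y => a y * _)) (HB c) => [u v|].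
  by rewrite rmorphD mulrDl.
move=> _ [c' [b [Bb ->]]]; apply: addspan_mem.
exists (a c' * mon (fun i => al i %/ q)%N), (a b * mon (fun i => f i : nat)).
split.
- apply: addspan_mem; exists c', (fun i => al i %/ q)%N; split=> // i.
  exact: leq_div2r.
- by apply: (allpairs_f (fun b f => a b * mon _)); rewrite ?mem_enum.
- by rewrite rmorphM rmorphXn exprMn mulrACA.
Qed.

Context {V : lmodType R}.
Variable s : seq V.

Definition gauge_le d : set V :=
  addspan [set v | exists r g, [/\ deg_le d r, g \in s & v = r *: g]].

Lemma gauge_leS d e : (d <= e)%N -> gauge_le d `<=` gauge_le e.
Proof.
move=> de; apply: addspanS => _ [r [g [dr sg ->]]]; apply: addspan_mem.
by exists r, g; split=> //; apply: deg_leS de _ dr.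
Qed.

Lemma gauge_leZ d e r v : deg_le d r -> gauge_le e v -> gauge_le (d + e) (r *: v).
Proof.
move=> dr; apply: addspan_map => [u w|_ [x [g [ex sg ->]]]].
  exact: scalerDr.
apply: addspan_mem; exists (r * x), g; split=> //; first exact: deg_leM.
by rewrite scalerA.
Qed.

Lemma submod_gauge_le d : submod (range a) (gauge_le d).
Proof.
apply: submod_addspan; first by exists (-1); rewrite // rmorphN1.
move=> _ _ [c _ <-] [r [g [dr sg ->]]]; exists (a c * r), g.
split=> //; last by rewrite scalerA.
by rewrite -[d]add0n; apply: deg_leM => //; apply: deg_le_scalar.
Qed.

Lemma gauge_le_fin d : exists s', gauge_le d `<=` lspan (range a) s'.
Proof.
exists [seq mon (fun i => f i : nat) *: g |
  f : {ffun 'I_(size t) -> 'I_d.+1} <- enum {ffun 'I_(size t) -> 'I_d.+1}, g <- s].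
set s' := [seq _ | _ <- _, _ <- _].
have sS := submod_lspan s' (subring_range a).
apply: addspan_min; [exact: submod0 sS|by move=> u v; apply: submodD sS|].
move=> _ [r [g [dr sg ->]]]; move: r dr.
apply: (@addspan_min _ _ (fun r => lspan _ _ (r *: g))).
- by rewrite scale0r; apply: submod0 sS.
- by move=> x y sx sy; rewrite scalerDl; apply: (submodD sS).
move=> _ [c [al [Hal ->]]]; rewrite -scalerA; apply: (submodZ sS); first by exists c.
apply: lspan_mem; first exact: subring_range.
have -> : mon al = mon (fun i => [ffun i => inord (al i) : 'I_d.+1] i : nat).
  by apply: eq_bigr => i _; rewrite ffunE inordK ?ltnS.
apply: (allpairs_f (fun f : {ffun 'I_(size t) -> 'I_d.+1} =>
    [eta *:%R (mon (fun i => f i : nat))])) => //.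
by rewrite mem_enum.
Qed.

Hypothesis deg_full : forall x, exists d, deg_le d x.
Hypothesis spanV : forall v, lspan setT s v.

Lemma gauge_le_exhaust v : exists d, gauge_le d v.
Proof.
apply: (lspan_min (N := [set v | exists d, gauge_le d v])) (spanV v).
  split.
  - by exists 0%N; apply: addspan0.
  - move=> u w [d du] [e ew]; exists (maxn d e).
    apply: (submodB (submod_gauge_le _)).
      exact: gauge_leS (leq_maxl _ _) _ du.
    exact: gauge_leS (leq_maxr _ _) _ ew.
  - move=> r u _ [e eu]; have [d dr] := deg_full r.
    by exists (d + e)%N; apply: gauge_leZ.
move=> w sw; exists 0%N; apply: addspan_mem; exists 1, w; rewrite scale1r.
by split=> //; rewrite -(rmorph1 a); apply: deg_le_scalar.
Qed.

Lemma gauge_le_seq (l : seq V) : exists d, forall v, v \in l -> gauge_le d v.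
Proof.
elim: l => [|v l [d dl]]; first by exists 0%N.
have [e ev] := gauge_le_exhaust v; exists (maxn d e) => w.
rewrite inE => /orP[/eqP ->|/dl]; last exact/gauge_leS/leq_maxl.
exact: gauge_leS (leq_maxr _ _) _ ev.
Qed.

End Gauge.

(** Above [2K + 2] the function drops by at least one at each step; at or below it, it stays
    there. *)
Lemma iter_half K d n :
  (iter n (fun d => d %/ 2 + K.+1) d <= maxn (K.+1).*2 (d - n))%N.
Proof.
elim: n => [|n IH]; first by rewrite subn0 leq_maxr.
by rewrite iterS; move: (iter n _ d) IH => x; lia.
Qed.

(** * p^(-e)-linear maps and their effect on gauges *)

Record cartier_map (p e : nat) (R : comPzRingType) (V : lmodType R)
    (phi : V -> V) : Prop := CartierMap {
  cartierD : {morph phi : u v / u + v};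
  cartierZ : forall r v, r *: phi v = phi (r ^+ (p ^ e) *: v) }.

Section CartierGauge.
Context {k : fieldType} {R : comPzRingType} (a : {rmorphism k -> R}).
Variables (t : seq R) (V : lmodType R) (s : seq V) (p : nat).
Hypotheses (hp : p \in [pchar k]) (hk : Ffinite p k).
Hypothesis deg_full : forall x, exists d, deg_le a t d x.
Hypothesis spanV : forall v, lspan setT s v.
Let G := gauge_le a t s.
Implicit Types (N : set V) (Psi : set (V -> V)) (phi : V -> V).

Definition growth K e phi := forall d v, G d v -> G (d %/ p ^ e + K) (phi v).

(** Since [phi (c ^+ (p ^ e) *: (h *: g)) = c *: phi (h *: g)], a gauge bound [K] for the finitely
    many [phi (h *: g)] suffices. *)
Lemma cartier_growth e phi : cartier_map p e phi -> exists K, growth K e phi.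
Proof.
move=> [phiD phiZ]; have [H _ decH] := deg_le_frobenius a t e hp hk.
have [K HK] := gauge_le_seq deg_full spanV
  [seq phi (h *: g) | h <- H, g <- s].
exists K => d; apply: addspan_map => // _ [r [g [dr sg ->]]].
apply: (addspan_map (f := fun r => phi (r *: g))) (decH d r dr) => [x y|].
  by rewrite scalerDl phiD.
move=> _ [c [h [dc Hh ->]]]; rewrite -scalerA -phiZ; apply: gauge_leZ => //.
by apply: HK; apply: (allpairs_f (fun h g => phi (h *: g))).
Qed.

Definition Cimg Psi N : set V :=
  addspan [set w | exists phi u, [/\ Psi phi, N u & w = phi u]].

Definition bounded K : set (V -> V) :=
  [set phi | exists e, [/\ (0 < e)%N, cartier_map p e phi & growth K e phi]].

Lemma CimgS Psi N N' : N `<=` N' -> Cimg Psi N `<=` Cimg Psi N'.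
Proof.
move=> NN'; apply: addspanS => _ [phi [u [Pphi Nu ->]]]; apply: addspan_mem.
by exists phi, u; split=> //; apply: NN'.
Qed.

Lemma submod_Cimg Psi N :
  (forall phi, Psi phi -> exists e, cartier_map p e phi) ->
  submod setT N -> submod setT (Cimg Psi N).
Proof.
move=> cPsi sN; apply: submod_addspan => // r _ _ [phi [u [Pphi Nu ->]]].
have [e [_ phiZ]] := cPsi _ Pphi; exists phi, (r ^+ (p ^ e) *: u).
by split=> //; apply: (submodZ sN).
Qed.

Definition generated_le N d :=
  forall v, N v -> addspan [set w | exists r u, [/\ N u, G d u & w = r *: u]] v.

Lemma generated_leS N d e : (d <= e)%N -> generated_le N d -> generated_le N e.
Proof.
move=> de gN v /gN; apply: addspanS => _ [r [u [Nu Gu ->]]]; apply: addspan_mem.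
by exists r, u; split=> //; apply: gauge_leS de _ Gu.
Qed.

(** Expand [r] as a sum of [c ^+ (p ^ e) * h]. The [c] come out of [phi], so the degree of [r] is
    irrelevant; the new generators [phi (h *: u)] have gauge at most [(p ^ e + d) %/ p ^ e + K], and
    [p ^ e >= 2]. *)
Lemma generated_Cimg Psi K N d : Psi `<=` bounded K -> submod setT N ->
  generated_le N d -> generated_le (Cimg Psi N) (d %/ 2 + K.+1).
Proof.
move=> PsiK sN gN.
apply: addspanS => _ [phi [v [Pphi Nv ->]]].
have [e [e0 [phiD phiZ] gphi]] := PsiK _ Pphi.
have q0 : (0 < p ^ e)%N by rewrite expn_gt0 prime_gt0 ?(pcharf_prime hp).
have q2 : (2 <= p ^ e)%N.
  have p1 := prime_gt1 (pcharf_prime hp).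
  by rewrite (leq_trans p1) // -{1}(expn1 p) leq_exp2l.
move: v Nv => v /gN; apply: addspan_map => // _ [r [u [Nu Gu ->]]].
have [H HH decH] := deg_le_frobenius a t e hp hk.
have [m dr] := deg_full r.
apply: (addspan_map (f := fun r => phi (r *: u))) (decH m r dr) => [x y|].
  by rewrite scalerDl phiD.
move=> _ [c [h [_ Hh ->]]]; rewrite -scalerA -phiZ; apply: addspan_mem.
exists c, (phi (h *: u)); split=> //.
  by apply: addspan_mem; exists phi, (h *: u); split=> //; apply: (submodZ sN).
have : G (p ^ e + d)%N (h *: u) by apply: gauge_leZ Gu; apply: HH.
move=> /gphi; apply: gauge_leS.
by rewrite -{1}(mul1n (p ^ e)%N) divnMDl // add1n addSnnS leq_add2r leq_div2l.
Qed.

Lemma submod_iter_Cimg Psi N n :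
  (forall phi, Psi phi -> exists e, cartier_map p e phi) ->
  submod setT N -> submod setT (iter n (Cimg Psi) N).
Proof. by move=> cPsi sN; elim: n => //= n; apply: submod_Cimg. Qed.

End CartierGauge.

(** * Descending chains *)

Section CartierDCC.
Context {k : fieldType} {R : comPzRingType} (a : {rmorphism k -> R}).
Variables (V : lmodType R) (s : seq V) (p : nat) (Phi : set (V -> V)).
Hypotheses (hp : p \in [pchar k]) (hk : Ffinite p k) (hR : finite_type a).
Hypothesis spanV : forall v, lspan setT s v.
Hypothesis cPhi : forall phi, Phi phi -> exists2 e, (0 < e)%N & cartier_map p e phi.
Implicit Types (N : set V) (J : nat -> set V).

Lemma acc_span : acc setT [set: V].
Proof.
have <- : lspan setT s = [set: V] by apply/seteqP; split=> // v _; apply: spanV.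
exact: noetherian hR.
Qed.

Lemma acc_ideal : acc setT [set: R^o].
Proof.
have spanR : lspan setT [:: 1 : R^o] = [set: R^o].
  apply/seteqP; split=> // r _.
  by exists r, 0; split=> //; rewrite addr0 [_ *: _]mulr1.
by have := noetherian (s := [:: 1 : R^o]) hR; rewrite spanR.
Qed.

(** [c *: phi u = phi (c ^+ (p ^ e) *: u)], and one factor [c] already brings [u] into [N']. *)
Lemma Cimg_scale (Psi : set (V -> V)) N N' c : Psi `<=` Phi -> submod setT N ->
  submod setT N' -> (forall v, N v -> N' (c *: v)) ->
  forall v, Cimg Psi N v -> Cimg Psi N' (c *: v).
Proof.
move=> PsiPhi sN sN' cN; apply: addspan_map => [u v|_ [phi [u [Pphi Nu ->]]]].
  exact: scalerDr.
have [e _ [_ phiZ]] := cPhi (PsiPhi _ Pphi); apply: addspan_mem.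
exists phi, (c ^+ (p ^ e) *: u); split=> //.
have q0 : (0 < p ^ e)%N by rewrite expn_gt0 prime_gt0 ?(pcharf_prime hp).
by rewrite -(prednK q0) exprSr -scalerA; apply: (submodZ sN') => //; apply: cN.
Qed.

Definition conductor N N' : set R^o := [set c | forall v, N v -> N' (c *: v)].

Lemma submod_conductor N N' : submod setT N' -> submod setT (conductor N N').
Proof.
move=> sN'; split=> [v _|x y cx cy v Nv|r x _ cx v Nv].
- by rewrite scale0r; apply: submod0 sN'.
- by rewrite scalerBl; apply: (submodB sN'); [apply: cx|apply: cy].
- by rewrite -scalerA; apply: (submodZ sN') => //; apply: cx.
Qed.

Section Chain.
Variable J : nat -> set V.
Hypothesis sJ : forall i, submod setT (J i).
Hypothesis stableJ : forall i phi v, Phi phi -> J i v -> J i (phi v).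
Hypothesis pureJ : forall i, J i `<=` Cimg Phi (J i).
Hypothesis dJ : forall i, J i.+1 `<=` J i.

Let Jinf : set V := \bigcap_i J i.

Let sJinf : submod setT Jinf.
Proof.
split=> [i _|u v Ju Jv i _|r u _ Ju i _]; first exact: submod0 (sJ i).
  by apply: (submodB (sJ i)); [apply: Ju|apply: Jv].
by apply: (submodZ (sJ i)) => //; apply: Ju.
Qed.

(* Purity makes [J i / Jinf] reduced: [c phi(v) = phi(c^(p^e) v)]. *)
Lemma conductor_radical i c :
  conductor (J i) Jinf (c ^+ p) -> conductor (J i) Jinf c.
Proof.
move=> cp v /pureJ.
apply: (@addspan_min _ _ (fun v => Jinf (c *: v))).
- by rewrite scaler0; apply: submod0 sJinf.
- by move=> x y Jx Jy; rewrite scalerDr; apply: (submodD sJinf).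
move=> _ [phi [u [Pphi Ju ->]]]; have [[//|e] _ [_ ->]] := cPhi Pphi.
have Jcu : Jinf (c ^+ (p ^ e.+1) *: u).
  have q0 : (0 < p ^ e)%N by rewrite expn_gt0 prime_gt0 ?(pcharf_prime hp).
  rewrite expnS exprM -(prednK q0) exprSr -scalerA.
  by apply: (submodZ sJinf) => //; apply: cp.
by move=> j _; apply: stableJ => //; apply: Jcu.
Qed.

(** Used on a tail of a chain along which the conductors are constant, where it yields a
    contradiction. *)
Lemma conductor_grows : ~ conductor (J 0) Jinf 1 ->
  exists i c, conductor (J i) Jinf c /\ ~ conductor (J 0) Jinf c.
Proof.
set I := conductor (J 0) Jinf => I1.
have sI : submod setT I := submod_conductor _ sJinf.
have IM r c : I c -> I (r * c) by move=> Ic; apply: (submodZ sI).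
(* The colon ideal (I : x) is maximal, hence prime. *)
have [x Ix xmax] : exists2 x, ~ I x & forall y, ~ I y ->
    ~ ([set r | I (r * x)] `<=` [set r | I (r * y)] /\
       ~ [set r | I (r * y)] `<=` [set r | I (r * x)]).
  apply: exists_extremal; last by exists 1.
  move=> f nIf ltf; have [| | |n] := @acc_ideal (fun n => [set r | I (r * f n)]).
  - move=> i; split=> [|u v|r u _] /=; first by rewrite mul0r; apply: submod0 sI.
      by move=> Iu Iv; rewrite mulrBl; apply: (submodB sI).
    by rewrite -mulrA; apply: IM.
  - by [].
  - by move=> i; case: (ltf i).
  - by move=> /(_ n.+1 (leqnSn n)); case: (ltf n).
pose Q : set R := [set r | ~ I (r * x)].
have QM r r' : Q r -> Q r' -> Q (r * r').
  (* [(I : r' x)] contains [(I : x)], so by maximality they agree, and [r * r'] in [(I : x)] would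
     force [r] into it. *)
  move=> Qr Qr' /= Irr'; apply: (xmax (r' * x) Qr'); split=> [c|sub] /=.
    by rewrite mulrCA; apply: IM.
  by apply: Qr; apply: sub; rewrite /= mulrA.
(* Otherwise [x ^+ 2], hence [x ^+ p], lies in [I], which is radical. *)
have Qx : Q x.
  move=> /= Ixx; apply: Ix; apply: conductor_radical.
  have p2 := prime_gt1 (pcharf_prime hp).
  by rewrite -(subnK p2) exprD; apply: IM; rewrite expr2.
have QnI c : Q c -> ~ I c by move=> Qc Ic; apply: Qc; rewrite /= mulrC; apply: IM.
have [s0 J0s0] := acc_fg acc_span (sJ 0) (@subsetT _ _).
have [i1 Hi1] : exists n, forall i, (n <= i)%N ->
    exists2 c, Q c & forall v, J n v -> J i (c *: v).
  apply: (@generic_dcc _ _ setT Q s0 x) => //.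
    by move=> i; rewrite -J0s0; apply: descending_le dJ (leq0n i).
  (* For [r] outside [Q] the product [r * x] is in [I], so it sends [J 0] into [Jinf]. *)
  move=> i r g _ nQr s0g; rewrite scalerA mulrC.
  have /contrapT/(_ g) : ~ ~ I (r * x) by move=> ?; apply: nQr.
  by apply=> //; rewrite J0s0; apply: lspan_mem => //; apply: subringT.
have [t Ht] := hR; have deg_full := deg_le_exhaust Ht.
pose G := gauge_le a t s; pose B K := Phi `&` bounded a t s p K.
have BPhi K : B K `<=` Phi by move=> phi [].
have cB K phi : B K phi -> exists e, cartier_map p e phi.
  by move=> [/cPhi[e _ ce] _]; exists e.
(* By noetherianity a part of [Phi] with uniformly bounded growth suffices. *)
have [K pureK] : exists K, J i1 `<=` Cimg (B K) (J i1).
  have [| | |K HK] := @acc_span (fun K => Cimg (B K) (J i1)).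
  - by move=> K; apply: submod_Cimg (sJ i1); apply: cB.
  - by [].
  - move=> K; apply: addspanS => _ [phi [u [[Pphi [e [e0 ce ge]]] Ju ->]]].
    apply: addspan_mem; exists phi, u; split=> //; split=> //; exists e.
    by split=> // d v /ge; apply: gauge_leS; rewrite addnS.
  exists K => v /pureJ; apply: addspanS => _ [phi [u [Pphi Ju ->]]].
  have [e e0 ce] := cPhi Pphi.
  have [K' gK'] := cartier_growth hp hk deg_full spanV ce.
  apply: (HK (maxn K K')); first exact: leq_maxl.
  apply: addspan_mem; exists phi, u; split=> //; split=> //; exists e.
  split=> // d w /gK'; apply: gauge_leS.
  by rewrite leq_add2l leq_maxr.
pose F n i := iter n (Cimg (B K)) (J i).
have sF n i : submod setT (F n i) by apply: submod_iter_Cimg (cB K) (sJ i).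
have FJ n i : F n i `<=` J i.
  elim: n => [//|n IH] v; apply: (@addspan_min _ _ (J i)).
  - exact: submod0 (sJ i).
  - by move=> u w; apply: (submodD (sJ i)).
  - by move=> _ [phi [u [[Pphi _] /IH Ju ->]]]; apply: stableJ.
(* Raising both indices together makes the diagonal chain used below descend. *)
have FS n i : F n.+1 i.+1 `<=` F n i.
  elim: n => [|n IH]; last exact: CimgS.
  by move=> v /FJ /dJ.
have FSl n i : F n.+1 i `<=` F n i.
  elim: n => [|n IH]; last exact: CimgS.
  exact: FJ.
(* By [pureK], the same [c] serves for every number of iterations. *)
have Fscale n i c : (forall v, J i1 v -> J i (c *: v)) ->
    forall v, J i1 v -> F n i (c *: v).
  move=> cJ; elim: n => [//|n IH] v /pureK.
  exact: Cimg_scale (BPhi K) (sJ i1) (sF n i) IH v.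
pose D := (K.+1).*2.
have genF i : exists n, forall m, (n <= m)%N -> generated_le a t s (F m i) D.
  (* This [d] may depend on [i]; the bound [D], reached after [d] iterations, does not. *)
  have [d gd] : exists d, generated_le a t s (J i) d.
    have [| | |d Hd] := @acc_span (fun d =>
        addspan [set w | exists r u, [/\ J i u, G d u & w = r *: u]]).
    - move=> d; apply: submod_addspan => // r _ _ [r' [u [Ju Gu ->]]].
      by exists (r * r'), u; rewrite scalerA.
    - by [].
    - move=> d; apply: addspanS => _ [r [u [Ju Gu ->]]]; apply: addspan_mem.
      by exists r, u; split=> //; apply: gauge_leS Gu.
    exists d => v Jv; have [d' Gv] := gauge_le_exhaust deg_full spanV v.
    apply: (Hd (maxn d d')); first exact: leq_maxl.
    apply: addspan_mem; exists 1, v; rewrite scale1r; split=> //.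
    exact: gauge_leS (leq_maxr _ _) _ Gv.
  have gF m : generated_le a t s (F m i) (iter m (fun d => d %/ 2 + K.+1)%N d).
    elim: m => [//|m IH]; apply: (generated_Cimg hp hk deg_full _ (sF m i) IH).
    by move=> phi [].
  exists d => m dm; apply: (generated_leS _ (gF m)).
  apply: leq_trans (iter_half K d m) _.
  by move: dm; rewrite -subn_eq0 => /eqP ->; rewrite maxn0.
have [s' Gs'] := gauge_le_fin a t s D.
(* The number of iterations grows with the index, so one chain in a finite dimensional space handles
   all [J j] at once. *)
have [| | |j1 Hj1] := @field_dcc _ _ _ a s' (fun j => G D `&` F j (i1 + j)%N).
- move=> j; apply: submodI; first exact: submod_gauge_le.
  exact: submodS (sF _ _).
- by move=> j v [Gv Fv]; split=> //; apply: FS; rewrite -addnS.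
- by move=> j v [/Gs'].
have [c Qc Hc] := Hi1 (i1 + j1)%N (leq_addr _ _).
exists i1, c; split; last exact: QnI.
have [n gn] := genF (i1 + j1)%N.
(* At least [n] iterations give generators in [G D]; at least [j1] place them in the stable term of
   the diagonal chain, hence in every [J j]. *)
move=> v Jv; have := gn (maxn n j1) (leq_maxl _ _) _ (Fscale _ _ _ Hc v Jv).
apply: (@addspan_min _ _ Jinf).
- exact: submod0 sJinf.
- by move=> u w; apply: (submodD sJinf).
move=> _ [r [u [Fu Gu ->]]]; apply: (submodZ sJinf) => // j _.
have Wu : (G D `&` F j1 (i1 + j1)%N) u.
  split=> //.
  exact: (descending_le (J := F^~ (i1 + j1)%N) (fun m => @FSl m _) (leq_maxr n j1)).
have [_ /FJ] := Hj1 (maxn j j1) (leq_maxr _ _) u Wu.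
by apply: (descending_le dJ); rewrite (leq_trans (leq_maxl j j1)) ?leq_addl.
Qed.

End Chain.

(** The conductors into the intersection stabilize at some [n]. Either they contain 1, and [J n] is
    the intersection, or [conductor_grows] contradicts stability. *)
Lemma cartier_dcc J :
  (forall i, submod setT (J i)) ->
  (forall i phi v, Phi phi -> J i v -> J i (phi v)) ->
  (forall i, J i `<=` Cimg Phi (J i)) ->
  (forall i, J i.+1 `<=` J i) ->
  exists n, forall i, (n <= i)%N -> J n `<=` J i.
Proof.
move=> sJ stJ pJ dJ.
have [| | |n Hn] := @acc_ideal (fun i => conductor (J i) (\bigcap_i J i)).
- move=> i; apply: submod_conductor; split=> [j _|u v Ju Jv j _|r u _ Ju j _].
  + exact: submod0 (sJ j).
  + by apply: (submodB (sJ j)); [apply: Ju|apply: Jv].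
  + by apply: (submodZ (sJ j)) => //; apply: Ju.
- by [].
- by move=> i c ci v /dJ; apply: ci.
have [c1|nc1] := pselect (conductor (J n) (\bigcap_i J i) 1).
  by exists n => i _ v /c1; rewrite scale1r; apply.
(* Dropping the first [n] terms keeps the intersection, so the conductors of the tail are the old
   ones. *)
have capE : \bigcap_i J (n + i)%N = \bigcap_i J i.
  apply/seteqP; split=> v Jv i _; last exact: Jv.
  by apply: (descending_le dJ (leq_addl n i)); apply: Jv.
have [| | | | |i [c [ci]]] := @conductor_grows (fun i => J (n + i)%N).
- by move=> i; apply: sJ.
- by move=> i; apply: stJ.
- by move=> i; apply: pJ.
- by move=> i; rewrite addnS; apply: dJ.
- by rewrite addn0 capE.
by rewrite addn0 capE; case; apply: (Hn (n + i)%N); rewrite ?leq_addr // -capE.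
Qed.

End CartierDCC.

(** * Cartier modules *)

(** Take the largest [N] with finitely many members below it. A least member above [N] would have
    only one more, against maximality; so [N] is the top of [T]. *)
Lemma finite_chain (X : Type) (T : set (set X)) :
  total_on T subset ->
  (forall f : nat -> set X, (forall n, T (f n)) -> ~ forall n, f n `<` f n.+1) ->
  (forall f : nat -> set X, (forall n, T (f n)) -> ~ forall n, f n.+1 `<` f n) ->
  finite_set T.
Proof.
move=> totT noasc nodesc.
have minT (S : set (set X)) : S `<=` T -> S !=set0 ->
    exists2 N, S N & forall N', S N' -> ~ N' `<` N.
  move=> ST; apply: (exists_extremal (r := fun N N' => N' `<` N)) => f Sf.
  by apply: nodesc => n; apply: ST.
have eqmin N N' : N' `<=` N -> ~ N' `<` N -> N' = N.
  move=> sub nsub; apply: contrapT => neq; apply: nsub.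
  by rewrite properEneq; split=> //; apply/eqP.
have [T0|/set0P/(minT T (@subset_refl _ _))[N0 TN0 N0min]] := eqVneq T set0.
  by rewrite T0; apply: finite_set0.
pose low N := T `&` [set N' | N' `<=` N].
pose A := T `&` [set N | finite_set (low N)].
have [| |N [TN finN] Nmax] := exists_extremal (r := fun N N' => N `<` N') (S := A).
- by move=> f Af; apply: noasc => n; case: (Af n).
- exists N0; split=> //=; apply: sub_finite_set (finite_set1 N0) => N' [TN' sub].
  by apply: eqmin => //; apply: N0min.
have [S0|/set0P] := eqVneq (T `&` [set N' | N `<` N']) set0.
  apply: sub_finite_set finN => N' TN'; split=> //=.
  have [//|sub] := totT N' N TN' TN.
  have [->//|neq] := eqVneq N' N.
  suff : (T `&` [set N' | N `<` N']) N' by rewrite S0.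
  by split=> //=; rewrite properEneq eq_sym.
move=> /(minT _ (@subIsetl _ _ _))[N1 [TN1 ltN1] N1min]; case: (Nmax N1) => //.
split=> //=; apply: (@sub_finite_set _ _ (low N `|` [set N1])).
  move=> N' [TN' sub]; have [le|le] := totT N' N TN' TN; first by left.
  have [->|neq] := eqVneq N' N; first by left; split.
  right; apply: eqmin => //; apply: N1min; split=> //=.
  by rewrite properEneq eq_sym.
by rewrite finite_setU; split=> //; apply: finite_set1.
Qed.

(** An alias of [M] keeps the [R]-module structure apart from the [C]-module structure. *)
Definition restrict_scalars (R C : pzRingType) (f : {rmorphism R -> C})
  (M : lmodType C) : Type := M.

Section RestrictScalars.
Context (R C : pzRingType) (f : {rmorphism R -> C}) (M : lmodType C).
Let V := restrict_scalars f M.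

HB.instance Definition _ := GRing.Zmodule.copy V M.

Let scale (r : R) (v : V) : V := f r *: (v : M).

Let scaleA r r' v : scale r (scale r' v) = scale (r * r') v.
Proof. by rewrite /scale scalerA rmorphM. Qed.
Let scale1 : left_id 1 scale.
Proof. by move=> v; rewrite /scale rmorph1 scale1r. Qed.
Let scaleDr : right_distributive scale +%R.
Proof. by move=> r u v; apply: scalerDr. Qed.
Let scaleDl v : {morph scale^~ v : r r' / r + r'}.
Proof. by move=> r r'; rewrite /scale rmorphD; apply: scalerDl. Qed.

HB.instance Definition _ :=
  GRing.Zmodule_isLmodule.Build R V scaleA scale1 scaleDr scaleDl.
End RestrictScalars.

Section CartierModules.
Context (p : nat) (R : comPzRingType) (C : pzRingType).
Context (iota : {rmorphism R -> C}) (gr : nat -> set C).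
Hypothesis hC : is_cartier_algebra p iota gr.
Variable M : lmodType C.
Let V := restrict_scalars iota M.

(** Only homogeneous elements act p^(-e)-linearly; elements of [Cplus gr] act by sums of these
    maps. *)
Definition structure_maps : set (V -> V) :=
  [set phi | exists2 e, (0 < e)%N & exists2 c, gr e c & phi = *:%R c :> (M -> M)].

Lemma cartier_structure_maps phi : structure_maps phi ->
  exists2 e, (0 < e)%N & cartier_map p e phi.
Proof.
move=> [e e0 [c ce ->]]; exists e => //; split=> [u v|r v].
  exact: (scalerDr c (u : M) (v : M)).
change (iota r *: (c *: (v : M)) = c *: (iota (r ^+ (p ^ e)) *: (v : M))).
by rewrite !scalerA (cartier_commute hC r ce).
Qed.

Lemma coherent_fg : coherent iota M -> exists s : seq V, forall v, lspan setT s v.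
Proof.
move=> [n [g Hg]]; exists [seq g i | i <- enum 'I_n] => v.
set s := [seq _ | _ <- _]; have sS := submod_lspan (s : seq V) subringT.
have [r ->] := Hg v.
apply: (big_ind (lspan setT (s : seq V))) => [|u w|i _].
- exact: submod0 sS.
- exact: (submodD sS).
- apply: (submodZ sS (r := r i)) => //; apply: lspan_mem; first exact: subringT.
  by apply: map_f; rewrite mem_enum.
Qed.

Section Submodule.
Variable N : set M.
Hypotheses (sN : is_submodule N) (pN : Fpure gr N).

Let N0 : N 0. Proof. by have [] := sN; rewrite inE. Qed.
Let NZD c u v : N u -> N v -> N (c *: u + v).
Proof. by have [_ +] := sN => /(_ c u v); rewrite !inE. Qed.

Lemma submodule_submod : submod setT (N : set V).
Proof.
split=> // [u v Nu Nv|r u _ Nu].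
  by have := NZD (-1) Nv Nu; rewrite scaleN1r addrC.
by have := NZD (iota r) Nu N0; rewrite addr0.
Qed.

Lemma submodule_stable phi v : structure_maps phi -> N v -> N (phi v).
Proof. by move=> [e _ [c _ ->]] Nv; have := NZD c Nv N0; rewrite addr0. Qed.

(** The right side is a [C]-submodule containing the products that generate [Cplus_mul gr N], which
    is [N] by purity. *)
Lemma Fpure_Cimg : N `<=` Cimg structure_maps (N : set V).
Proof.
rewrite -{1}pN => v /(_ (Cimg structure_maps (N : set V))); apply; split.
  split; first by rewrite inE; apply: addspan0.
  move=> c u w; rewrite !inE => Nu Nw; apply: addspanD => //.
  move: u Nu; apply: (addspan_map (W := M) (W' := M)) => [u v'|].
    exact: scalerDr.
  move=> _ [_ [u [[e e0 [d de ->]] Nu ->]]].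
  (* A component of [c] may have degree 0, but its product with [d] still has positive degree
     [i + e]. *)
  have [n [f [fgr ->]]] := graded_sum (cartier_graded hC) c.
  rewrite scalerA mulr_suml scaler_suml; apply: addspan_sum => i.
  apply: addspan_mem; exists ( *:%R (f i * d)), u; split=> //.
  exists (i + e)%N; first by rewrite addn_gt0 e0 orbT.
  by exists (f i * d) => //; exact: (gradedM (cartier_graded hC)).
move=> _ [_ [n [f [fgr ->]]] [u Nu <-]]; rewrite scaler_suml big_nat.
apply: (big_ind (Cimg structure_maps (N : set V))) => [|x y|i /andP[i0 _]].
- exact: addspan0.
- exact: addspanD.
apply: addspan_mem; exists ( *:%R (f i)), u; split=> //.
by exists i => //; exists (f i).
Qed.

End Submodule.
End CartierModules.

Unset Implicit Arguments.

Theorem corollary4p14 (p : nat) (k : fieldType) (hp : p \in [pchar k])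
    (hk : Ffinite p k)
    (R : comPzRingType) (a : {rmorphism k -> R}) (hR : finite_type a)
    (C : pzRingType) (iota : {rmorphism R -> C}) (gr : nat -> set C)
    (hC : is_cartier_algebra p iota gr)
    (M : lmodType C) (hcoh : coherent iota M) (hpure : Fpure gr [set: M]) :
  finite_Fpure_length gr M.
Proof.
move=> T HT totT; have [s spanV] := coherent_fg hcoh.
(* Strictly ascending sequences contradict noetherianity over [R], strictly descending ones
   [cartier_dcc]. *)
apply: finite_chain => // f Tf mono.
  have [| | |n] := acc_span hR spanV (J := f).
  - by move=> i; have [sN _] := HT _ (Tf i); apply: submodule_submod.
  - by [].
  - by move=> i; have [] := mono i.
  by move=> /(_ n.+1 (leqnSn n)); have [] := mono n.
have [| | | |n] := cartier_dcc hp hk hR spanV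
  (cartier_structure_maps hC (M := M)) (J := f).
- by move=> i; have [sN _] := HT _ (Tf i); apply: submodule_submod.
- by move=> i phi v Pphi; have [sN _] := HT _ (Tf i); apply: (submodule_stable sN Pphi).
- by move=> i; have [_ pN] := HT _ (Tf i); exact: (Fpure_Cimg hC pN).
- by move=> i; have [] := mono i.
by move=> /(_ n.+1 (leqnSn n)); have [] := mono n.
Qed.
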